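(* Let $\{\Psi^n\}_{n\in\mathbb N}$ be a sequence of good semimartingales and let $\{Z^n\}_{n\in\mathbb N}$ be a sequence of $\mathbb D$-valued stochastic processes, defined on some probability space $(\Omega,\mathcal F,\mathbb P)$, such that for every $n$: (i) the sample paths of $Z^n$ are almost surely of zero quadratic variation on compact sets, and $\mathbb P\{Z^n_0=0\}=1$; (ii) the stochastic integrals $\int\Psi^n\,dZ^n$ and $\int Z^n\,dZ^n$ exist (as limits in probability of Stieltjes-type sums, see context), and the sample paths $t\mapsto\int_0^tZ^n_{s-}\,dZ^n_s$ and $t\mapsto\int_0^t\Psi^n_{s-}\,dZ^n_s$ are càdlàg. If $\Psi$ is a continuous semimartingale and $B^H$ is a fractional Brownian motion with Hurst parameter $H>\frac12$, then the convergence $\mathcal L\text{-}\lim_{n\to\infty}(\Psi^n,Z^n)=(\Psi,B^H)$ implies the convergence $$\mathcal L\text{-}\lim_{n\to\infty}\left(\Psi^n,Z^n,\int\Psi^n\,dZ^n\right)=\left(\Psi,B^H,\int\Psi\,dB^H\right).$$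
   Context: $\mathbb D$ is the Skorohod space of real-valued right-continuous functions with left limits, and $\mathcal L\text{-}\lim$ denotes convergence in distribution (weak convergence in the Skorohod topology). Integrals. For adapted processes $\phi,Z$ on a filtered probability space, $\int\phi\,dZ$ denotes $\int\phi_{s-}\,dZ_s$. It is said to exist if for every $T<\infty$ and every sequence of partitions $\tau^l=(\tau^l_1,\dots,\tau^l_{N_l})$ of $[0,T]$ with $\lim_{l\to\infty}\max_i|\tau^l_{i+1}-\tau^l_i|=0$, $$\int_0^T\phi_{s-}\,dZ_s=\mathbb P\text{-}\lim_{l\to\infty}\sum_i\phi_{\tau^l_i}(Z_{\tau^l_{i+1}}-Z_{\tau^l_i}),$$ where $\mathbb P\text{-}\lim$ is the limit in probability. This covers the usual integrals of càdlàg processes against semimartingales, and $\int\Psi\,dB^H$ exists in this sense for continuous semimartingales $\Psi$ and $H>\frac12$. Good. A sequence $\{\Psi^n\}$ of semimartingales (on probability spaces $(\Omega^n,\mathcal F^n,\mathbb P^n)$) is called good if, for any sequence $\{Z^n\}$ of càdlàg adapted processes, the convergence $\mathcal L\text{-}\lim_n(\Psi^n,Z^n)=(\Psi,Z)$ implies $\mathcal L\text{-}\lim_n(\Psi^n,Z^n,\int Z^n\,d\Psi^n)=(\Psi,Z,\int Z\,d\Psi)$. *)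

(* Defs.v *)
From HB Require Import structures.
From mathcomp Require Import all_boot all_order all_algebra.
From mathcomp Require Import all_classical all_reals all_analysis.

Set Implicit Arguments.
Unset Strict Implicit.
Unset Printing Implicit Defensive.

Import Order.TTheory GRing.Theory Num.Theory.
Import numFieldNormedType.Exports.

Local Open Scope classical_set_scope.
Local Open Scope ring_scope.

(* Time is [0, +oo[; it is embedded in R and every notion below only looks at
   times t >= 0. *)

Section skorohod_space.
Context {R : realType}.

Definition cadlag (E : normedModType R) (f : R -> E) :=
  (forall t, 0 <= t -> f x @[x --> t^'+] --> f t) /\
  (forall t, 0 < t -> cvg (f x @[x --> t^'-])).

Record skorohod (E : normedModType R) := Skorohod {
  skorohod_path :> R -> E ;
  skorohod_cadlag : cadlag skorohod_path }.

HB.instance Definition _ (E : normedModType R) := gen_eqMixin (skorohod E).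
HB.instance Definition _ (E : normedModType R) := gen_choiceMixin (skorohod E).

(* Increasing bijections of [0, +oo[ onto itself; they are automatically
   continuous and fix 0. *)
Definition time_change (lam : R -> R) :=
  set_bij `[0, +oo[ `[0, +oo[ lam /\
  {in `[0, +oo[ &, {mono lam : s t / s <= t}}.

(* Basic neighbourhoods of x for the Skorohod (J1) topology of D([0, +oo[; E):
   x_n --> x iff for every T there are time changes lam_n with
   sup_(t <= T) |lam_n t - t| --> 0 and sup_(t <= T) |x_n (lam_n t) - x t| --> 0
   (Ethier-Kurtz, Prop. 3.5.3; Jacod-Shiryaev, Thm VI.1.14). *)
Definition skorohod_ball (E : normedModType R) (T e : R) (x : skorohod E) :
    set (skorohod E) :=
  [set y | exists2 lam, time_change lam & forall t, 0 <= t <= T ->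
     `|lam t - t| < e /\ `|y (lam t) - x t| < e].

Definition skorohod_nbhs (E : normedModType R) (x : skorohod E) :
    set_system (skorohod E) :=
  [set A | exists T e, 0 < e /\ skorohod_ball T e x `<=` A].

HB.instance Definition _ (E : normedModType R) :=
  hasNbhs.Build (skorohod E) (@skorohod_nbhs E).

Lemma time_change_id : time_change id.
Proof. by split=> //; split=> // t; exists t. Qed.

Lemma time_change_comp (lam mu : R -> R) :
  time_change lam -> time_change mu -> time_change (mu \o lam).
Proof.
move=> [lamb lamm] [mub mum]; split; first exact: set_bij_comp lamb mub.
case: lamb => lamf _ _ s t s0 t0 /=.
have lam0 u : u \in `[0, +oo[ -> lam u \in `[0, +oo[ by exact: lamf.
by rewrite mum ?lam0// lamm.
Qed.

Lemma skorohod_ball_center (E : normedModType R) T e (x : skorohod E) :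
  0 < e -> skorohod_ball T e x x.
Proof.
by move=> e0; exists id => [|t _]; [exact: time_change_id|rewrite !subrr !normr0].
Qed.

Lemma skorohod_ball_sub (E : normedModType R) T T' e e' (x : skorohod E) :
  T <= T' -> e' <= e -> skorohod_ball T' e' x `<=` skorohod_ball T e x.
Proof.
move=> TT' ee' y [lam lamt ylam]; exists lam => // t /andP[t0 tT].
have [|? ?] := ylam t; first by rewrite t0 (le_trans tT).
by split; apply: lt_le_trans ee'.
Qed.

Lemma skorohod_ball_triangle (E : normedModType R) T e (x y : skorohod E) :
  skorohod_ball T (e / 2) x y ->
  skorohod_ball (T + e / 2) (e / 2) y `<=` skorohod_ball T e x.
Proof.
move=> [lam lamt ylam] z [mu mut zmu]; exists (mu \o lam).
  exact: time_change_comp.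
move=> t tT; have [lamte ylamte] := ylam t tT; case/andP: tT => t0 tT.
have lam0 : 0 <= lam t.
  have [[lamf _ _] _] := lamt.
  by have := lamf t; rewrite /= !in_itv/= !andbT; apply.
have [|mue zmue] := zmu (lam t).
  rewrite lam0/=; move: lamte => /(le_lt_trans (ler_norm _)).
  by rewrite ltrBlDl => /ltW /le_trans; apply; rewrite lerD2r.
split; rewrite (splitr e).
  rewrite /= -(subrKA (lam t) (mu _)).
  exact: le_lt_trans (ler_normD _ _) (ltrD _ _).
rewrite /= -(subrKA (y (lam t)) (z _)).
exact: le_lt_trans (ler_normD _ _) (ltrD _ _).
Qed.

Lemma skorohod_nbhs_filter (E : normedModType R) (x : skorohod E) :
  ProperFilter (nbhs x).
Proof.
split.
  by move=> [T [e [e0 /(_ x)]]]; apply; exact: skorohod_ball_center.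
split.
- by exists 0, 1.
- move=> A B [T [e [e0 TeA]]] [T' [e' [e'0 TeB]]].
  exists (Num.max T T'), (Num.min e e'); split; first by rewrite lt_min e0 e'0.
  move=> y xy; split; [apply: TeA|apply: TeB];
    by apply: skorohod_ball_sub xy; rewrite ?le_max ?ge_min lexx ?orbT.
- by move=> A B AB [T [e [e0 TeA]]]; exists T, e; split=> //; exact: subset_trans AB.
Qed.

Lemma skorohod_nbhs_singleton (E : normedModType R) (x : skorohod E) A :
  nbhs x A -> A x.
Proof. by move=> [T [e [e0 TeA]]]; apply: TeA; exact: skorohod_ball_center. Qed.

Lemma skorohod_nbhs_nbhs (E : normedModType R) (x : skorohod E) A :
  nbhs x A -> nbhs x (nbhs^~ A).
Proof.
move=> [T [e [e0 TeA]]]; exists T, (e / 2); split; first by rewrite divr_gt0.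
move=> y xy; exists (T + e / 2), (e / 2); split; first by rewrite divr_gt0.
exact: subset_trans (skorohod_ball_triangle xy) TeA.
Qed.

HB.instance Definition _ (E : normedModType R) :=
  Nbhs_isNbhsTopological.Build (skorohod E)
    (@skorohod_nbhs_filter E) (@skorohod_nbhs_singleton E) (@skorohod_nbhs_nbhs E).

Lemma cadlag_pair (E E' : normedModType R) (f : R -> E) (g : R -> E') :
  cadlag f -> cadlag g -> cadlag (fun t => (f t, g t)).
Proof.
move=> [fr fl] [gr gl]; split=> t t0.
  by apply: cvg_pair; [exact: fr|exact: gr].
have /cvg_ex[l fl_] := fl _ t0; have /cvg_ex[m gm_] := gl _ t0.
by apply/cvg_ex; exists (l, m); exact: cvg_pair.
Qed.

(* The vector-valued path of D([0, +oo[; E * E'): a common time change acts on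
   both coordinates. *)
Definition skorohod_pair (E E' : normedModType R) (x : skorohod E)
    (y : skorohod E') : skorohod (E * E')%type :=
  Skorohod (cadlag_pair (skorohod_cadlag x) (skorohod_cadlag y)).

Definition joint2 (T : Type) (X Y : T -> skorohod R) :=
  fun w => skorohod_pair (X w) (Y w).

Definition joint3 (T : Type) (X Y Z : T -> skorohod R) :=
  fun w => skorohod_pair (skorohod_pair (X w) (Y w)) (Z w).

End skorohod_space.

Section convergence_in_law.
Context {R : realType}.
Local Open Scope ereal_scope.

(* For E = R^k, real-valued Skorohod-continuous functionals are measurable for
   the sigma-algebra of the coordinates, so that the expectations below are those of
   random variables as soon as the coordinates of X n and Y are. *)
Definition cvg_in_law (E : normedModType R)
    (d : nat -> measure_display) (T : forall n, measurableType (d n))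
    (P : forall n, probability (T n) R) (X : forall n, T n -> skorohod E)
    (d' : measure_display) (T' : measurableType d')
    (P' : probability T' R) (Y : T' -> skorohod E) :=
  forall F : skorohod E -> R, continuous F ->
    (exists M : R, forall x, (`|F x| <= M)%R) ->
    'E_(P n)[fun w => F (X n w)] @[n --> \oo] --> 'E_P'[fun w => F (Y w)].

End convergence_in_law.

Section processes.
Context {R : realType} {d : measure_display} {T : measurableType d}.
Variable P : probability T R.
Implicit Types (F : R -> set (set T)) (X Z I M A B : T -> skorohod R).

Definition process X :=
  forall t, 0 <= t -> measurable_fun [set: T] (fun w => X w t).

Definition continuous_paths X :=
  {ae P, forall w, {within `[0, +oo[, continuous (X w)}}.

Definition filtration F :=
  (forall t, 0 <= t -> sigma_algebra [set: T] (F t) /\ F t `<=` measurable) /\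
  (forall s t, 0 <= s -> s <= t -> F s `<=` F t).

Definition sub_measurable (G : set (set T)) (f : T -> R) :=
  forall C : set R, measurable C -> G (f @^-1` C).

Definition adapted F X :=
  forall t, 0 <= t -> sub_measurable (F t) (fun w => X w t).

(* g is a version of the conditional expectation of f given G *)
Definition cond_expectation (G : set (set T)) (f g : T -> R) :=
  [/\ sub_measurable G g, P.-integrable [set: T] (EFin \o g) &
      forall C, G C ->
        (\int[P]_(w in C) (g w)%:E = \int[P]_(w in C) (f w)%:E)%E].

Definition martingale F (X : T -> R -> R) :=
  [/\ forall t, 0 <= t -> sub_measurable (F t) (fun w => X w t),
      forall t, 0 <= t -> P.-integrable [set: T] (fun w => (X w t)%:E) &
      forall s t, 0 <= s -> s <= t ->
        cond_expectation (F s) (fun w => X w t) (fun w => X w s)].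

Definition stopping_time F (tau : T -> \bar R) :=
  (forall w, 0 <= tau w)%E /\
  (forall t, 0 <= t -> F t [set w | (tau w <= t%:E)%E]).

Definition stopped (tau : T -> \bar R) X : T -> R -> R :=
  fun w t => X w (fine (Order.min t%:E (tau w))).

Definition local_martingale F M :=
  adapted F M /\
  exists tau : nat -> T -> \bar R,
    [/\ forall k, stopping_time F (tau k),
        forall w k l, (k <= l)%N -> (tau k w <= tau l w)%E,
        {ae P, forall w, tau k w @[k --> \oo] --> +oo%E} &
        forall k, martingale F (fun w t => stopped (tau k) M w t - M w 0)].

Definition finite_variation A :=
  {ae P, forall w, forall t, 0 <= t -> bounded_variation 0 t (A w)}.

Definition semimartingale F X :=
  adapted F X /\
  exists M A, [/\ local_martingale F M, adapted F A, finite_variation A &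
    {ae P, forall w, forall t, 0 <= t -> X w t = M w t + A w t}].

(* As in [itv_partition], the subdivision 0 < s_1 < ... < s_N = t of [0, t]
   is encoded by the list s of its points other than 0. *)
Definition mesh (t : R) (s : seq R) : R :=
  \big[Num.max/0]_(i < size s) (nth t (0 :: s) i.+1 - nth t (0 :: s) i).

Definition stieltjes_sum (t : R) (s : seq R) (f g : R -> R) : R :=
  \sum_(i < size s) f (nth t (0 :: s) i) *
    (g (nth t (0 :: s) i.+1) - g (nth t (0 :: s) i)).

Definition fine_partitions (t : R) (s : nat -> seq R) :=
  (forall l, itv_partition 0 t (s l)) /\ mesh t (s l) @[l --> \oo] --> (0 : R).

Definition cvg_in_probability (f : nat -> T -> R) (g : T -> R) :=
  forall e : R, 0 < e ->
    P [set w | e <= `|f l w - g w|] @[l --> \oo] --> 0%E.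

(* I is a cadlag version of t |-> \int_0^t X_{u-} dZ_u: one exists iff the
   integral exists and has cadlag sample paths up to modification. *)
Definition stoch_integral X Z I :=
  process I /\
  forall t, 0 <= t -> forall s : nat -> seq R, fine_partitions t s ->
    cvg_in_probability (fun l w => stieltjes_sum t (s l) (X w) (Z w))
                       (fun w => I w t).

Definition zero_quadratic_variation (z : R -> R) :=
  forall t, 0 <= t -> forall s : nat -> seq R, fine_partitions t s ->
    (\sum_(i < size (s l))
        (z (nth t (0 :: s l) i.+1) - z (nth t (0 :: s l) i)) ^+ 2)
      @[l --> \oo] --> (0 : R).

(* Constants are Gaussian; they are treated apart because [normal_prob] is not
   a Dirac mass when the standard deviation is 0. *)
Definition gaussian_rv (f : T -> R) :=
  measurable_fun [set: T] f /\
  ((exists m s : R, 0 < s /\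
      forall C : set R, measurable C -> P (f @^-1` C) = normal_prob m s C) \/
   (exists m : R, P [set w | f w = m] = 1%E)).

Definition gaussian_process X :=
  forall (n : nat) (t a : 'I_n -> R), (forall i, 0 <= t i) ->
    gaussian_rv (fun w => \sum_(i < n) a i * X w (t i)).

Definition fractional_brownian_motion (H : R) B :=
  [/\ 0 < H <= 1, continuous_paths B, gaussian_process B,
      forall t, 0 <= t -> 'E_P[fun w => B w t]%E = 0%E &
      forall s t, 0 <= s -> 0 <= t ->
        'E_P[fun w => (B w s * B w t)%R]%E =
        (2^-1 * (s `^ (2 * H) + t `^ (2 * H) - `|t - s| `^ (2 * H)))%:E].

End processes.

(* A good sequence of semimartingales. The n-th one lives on the filtered space
   (T n, F n, P n), and the limit (psi, z) on an arbitrary space. As integrals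
   are only determined up to indistinguishability, J n is any cadlag version of
   \int Z^n dPsi^n and j some cadlag version of \int z dpsi. *)
Definition good {R : realType}
    (d : nat -> measure_display) (T : forall n, measurableType (d n))
    (P : forall n, probability (T n) R) (F : forall n, R -> set (set (T n)))
    (Psi : forall n, T n -> skorohod R) :=
  (forall n, semimartingale (P n) (F n) (Psi n)) /\
  forall Z J : forall n, T n -> skorohod R,
    (forall n, adapted (F n) (Z n)) ->
    (forall n, stoch_integral (P n) (Z n) (Psi n) (J n)) ->
  forall (d' : measure_display) (T' : measurableType d')
    (P' : probability T' R) (psi z : T' -> skorohod R),
    process psi -> process z ->
    cvg_in_law P (fun n => joint2 (Psi n) (Z n)) P' (joint2 psi z) ->
    exists2 j, stoch_integral P' z psi j &
      cvg_in_law P (fun n => joint3 (Psi n) (Z n) (J n)) P' (joint3 psi z j).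

(* Main.v *)
(* Discrete summation by parts reads
     S(Psi, Z) + S(Z, Psi) + sum dPsi dZ = Psi Z - Psi_0 Z_0.
   The cross sums vanish in probability, by Cauchy-Schwarz, as soon as the sums
   of squared increments of Z vanish while those of Psi are tight. Hence
   J^n := Psi^n Z^n - Psi^n_0 Z^n_0 - int Psi^n dZ^n is a version of
   int Z^n dPsi^n, and goodness gives the convergence in law of
   (Psi^n, Z^n, J^n). The map (x, y, z) |-> (x, y, x y - x_0 y_0 - z) is
   continuous for the J1 topology and turns J^n back into int Psi^n dZ^n; the
   same summation by parts identifies the limit, because
   E[sum (dB^H)^2] = sum (dt)^(2H) --> 0 for H > 1/2.
   Tightness of the sums of squares of a local martingale is a weak type
   estimate: the increments of the Huber function, which is quadratic on
   [-b, b] and grows linearly outside, control the sum of squares on the event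
   that the path stays in [-b, b]. *)
Require Import Defs.
From mathcomp Require Import all_boot all_order all_algebra.
From mathcomp Require Import all_classical all_reals all_analysis.
From mathcomp Require Import measurable_realfun ring lra.
Import Order.TTheory GRing.Theory Num.Theory.
Import numFieldNormedType.Exports.
Local Open Scope classical_set_scope.
Local Open Scope ring_scope.

Set Implicit Arguments.
Unset Strict Implicit.
Unset Printing Implicit Defensive.

(** * Bounds on càdlàg paths, and J1-continuity of the integration by parts map *)

Section paths.
Context {R : realType}.

(** One-sided limits bound the path near each point, and compactness of the segment makes finitely
    many of these local bounds suffice. *)
Lemma cadlag_bounded (E : normedModType R) (f : R -> E) (t : R) :
  cadlag f -> exists K : R, forall s, 0 <= s <= t -> `|f s| <= K.
Proof.
move=> [fr fl].
have loc (x : R) : 0 <= x ->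
    exists l : R, \forall y \near x, 0 <= y -> `|f y| <= l.
  move=> x0.
  have [l fxl] : exists l : R, \forall y \near x, y < x -> 0 <= y -> `|f y| <= l.
    have [->|xneq0] := eqVneq x 0.
      by exists 0; near=> y => y0 /(lt_le_trans y0); rewrite ltxx.
    have x_gt0 : 0 < x by rewrite lt0r xneq0.
    have /cvg_ex[l /cvgrPdist_lt/(_ 1 ltr01) fxl] := fl _ x_gt0.
    have {}fxl : \forall y \near x, y < x -> `|l - f y| < 1 := fxl.
    exists (1 + `|l|); apply: filterS fxl => y yl yx _; have := yl yx => fyl.
    rewrite -lerBlDr (le_trans (lerB_dist _ _))// distrC ltW//.
  have /cvgrPdist_lt/(_ 1 ltr01) fxr := fr _ x0.
  have {}fxr : \forall y \near x, x < y -> `|f x - f y| < 1 := fxr.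
  exists (Num.max l (1 + `|f x|)).
  apply: filterS2 fxl fxr => y yl yr y0; rewrite le_max.
  have [yx|xy|->] := ltgtP y x.
  - by rewrite yl.
  - apply/orP; right.
    by rewrite -lerBlDr (le_trans (lerB_dist _ _))// distrC ltW// yr.
  - by rewrite lerDr ler01 orbT.
have cpt : near_covering_within `[0, t].
  by apply/near_covering_withinP/compact_near_coveringP/segment_compact.
have : \forall K \near +oo, `[0, t] `<=` [set y | `|f y| <= K].
  apply: (cpt R (nbhs +oo) (fun K y => `|f y| <= K)) => x.
  rewrite /= in_itv/= => /andP[x0 xt].
  have [l lx] := loc _ x0.
  have lK : \forall K \near +oo, l <= K by apply: nbhs_pinfty_ge; exact: num_real.
  exists ([set y | 0 <= y -> `|f y| <= l], [set K | l <= K]) => //= -[y K] /=.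
  by move=> [yl lK'] /[!in_itv]/= /andP[/yl yl0 _]; exact: le_trans yl0 lK'.
move=> /filter_ex[K bnd]; exists K => s st.
by apply: bnd; rewrite /= in_itv.
Unshelve. all: by end_near. Qed.

Lemma skorohod_eq (E : normedModType R) (x y : skorohod E) :
  (forall t, x t = y t) -> x = y.
Proof.
case: x y => [f fc] [g gc] /= /funext fg; subst g.
by rewrite (Prop_irrelevance fc gc).
Qed.

Lemma cadlag_fst (E E' : normedModType R) (f : R -> E * E') :
  cadlag f -> cadlag (fun t => (f t).1).
Proof.
move=> [fr fl]; split=> t t0.
  exact: (cvg_comp _ _ (fr t t0) cvg_fst).
have /cvg_ex[l fl_] := fl _ t0; apply/cvg_ex; exists l.1.
exact: (cvg_comp _ _ fl_ cvg_fst).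
Qed.

Lemma cadlag_snd (E E' : normedModType R) (f : R -> E * E') :
  cadlag f -> cadlag (fun t => (f t).2).
Proof.
move=> [fr fl]; split=> t t0.
  exact: (cvg_comp _ _ (fr t t0) cvg_snd).
have /cvg_ex[l fl_] := fl _ t0; apply/cvg_ex; exists l.2.
exact: (cvg_comp _ _ fl_ cvg_snd).
Qed.

Definition skorohod_fst (E E' : normedModType R)
  (x : skorohod (E * E')%type) : skorohod E :=
  Skorohod (cadlag_fst (skorohod_cadlag x)).

Definition skorohod_snd (E E' : normedModType R)
  (x : skorohod (E * E')%type) : skorohod E' :=
  Skorohod (cadlag_snd (skorohod_cadlag x)).

Lemma cadlag_by_parts (x y z : skorohod R) :
  cadlag (fun t => x t * y t - x 0 * y 0 - z t).
Proof.
have [xr xl] := skorohod_cadlag x; have [yr yl] := skorohod_cadlag y.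
have [zr zl] := skorohod_cadlag z.
split=> t t0.
  apply: cvgB; last exact: zr.
  by apply: cvgB; [apply: cvgM; [exact: xr|exact: yr]|exact: cvg_cst].
apply: is_cvgB; last exact: zl.
by apply: is_cvgB; [apply: is_cvgM; [exact: xl|exact: yl]|exact: is_cvg_cst].
Qed.

(* When z is the integral of x against y and the covariation of x and y
   vanishes, this is the integral of y against x. *)
Definition by_parts (x y z : skorohod R) : skorohod R :=
  Skorohod (cadlag_by_parts x y z).

Definition by_parts_map (v : skorohod (R * R * R)%type) :
    skorohod (R * R * R)%type :=
  skorohod_pair (skorohod_fst v)
    (by_parts (skorohod_fst (skorohod_fst v)) (skorohod_snd (skorohod_fst v))
       (skorohod_snd v)).

Lemma by_parts_map_pair (x y z : skorohod R) :
  by_parts_map (skorohod_pair (skorohod_pair x y) z) =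
  skorohod_pair (skorohod_pair x y) (by_parts x y z).
Proof. exact: skorohod_eq. Qed.

(** Thus the map that produces the integrals against [Psi n] also gives back the original ones. *)
Lemma by_partsK (x y : skorohod R) : involutive (by_parts x y).
Proof. by move=> z; apply: skorohod_eq => t /=; rewrite opprB addrC subrK. Qed.

(** An increasing surjection sends the least point to the least point. The term [x 0 * y 0] of
    [by_parts] is therefore compared at time 0 on both sides. *)
Lemma time_change0 (lam : R -> R) : time_change lam -> lam 0 = 0.
Proof.
move=> [[lamf _ lamsurj] lamm].
have in0 : (0 : R) \in `[0, +oo[ by rewrite in_itv/= lexx.
have [u u0 lamu] := lamsurj 0 in0.
have := lamf 0 in0; rewrite /= in_itv/= andbT => lam0.
apply/eqP; rewrite eq_le lam0 andbT -[leRHS]lamu lamm//.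
by move: u0; rewrite /= in_itv/= andbT.
Qed.

(** The two linear terms cost at most [dl * (C - 1)] each and the quadratic one at most [dl],
    because [dl <= 1]; the margin between [C - 1] and [C] absorbs the latter. *)
Lemma mulr_dist (a b a' b' dl C : R) : dl <= 1 -> 0 <= C ->
  `|a' - a| <= dl -> `|b' - b| <= dl -> `|a| <= C - 1 -> `|b| <= C - 1 ->
  `|a' * b' - a * b| <= 2 * (dl * C).
Proof.
move=> dl1 C0 aa bb aC bC.
have -> : a' * b' - a * b = (a' - a) * (b' - b) + (a' - a) * b + a * (b' - b).
  by ring.
have dl0 : 0 <= dl by apply: le_trans aa.
have h1 : `|(a' - a) * (b' - b)| <= dl * 1.
  by rewrite normrM ler_pM// (le_trans bb).
have h2 : `|(a' - a) * b| <= dl * (C - 1) by rewrite normrM ler_pM.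
have h3 : `|a * (b' - b)| <= (C - 1) * dl by rewrite normrM ler_pM.
apply: (le_trans (ler_normD _ _)).
apply: (le_trans (lerD (ler_normD _ _) (lexx _))); nra.
Qed.

(** The time change that matches the arguments also matches the images, since multiplication is
    Lipschitz on bounded sets and time 0 is fixed. *)
Lemma by_parts_map_continuous : continuous by_parts_map.
Proof.
move=> x A [t [e [e0 teA]]].
have [K xK] := cadlag_bounded t (skorohod_cadlag x).
pose C := `|K| + 1; have C0 : 0 < C by rewrite ltr_wpDl.
have C1 : 1 <= C by rewrite /C lerDr.
(* Each of the two products moves by at most [2 * (dl * C) <= e / 4] and the third coordinate by at
   most [e / 8], which leaves the total below [e]. *)
pose dl := Num.min 1 (e / (8 * C)).
have dl0 : 0 < dl by rewrite lt_min ltr01 divr_gt0// mulr_gt0.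
have dl1 : dl <= 1 by rewrite ge_min lexx.
have dle : dl * C <= e / 8.
  have : dl <= e / (8 * C) by rewrite ge_min lexx orbT.
  by rewrite ler_pdivlMr ?mulr_gt0// ler_pdivlMr// (mulrC 8) mulrA.
exists t, dl; split=> // y [lam lamt xy]; apply: teA; exists lam => // s st.
have [lams xys] := xy _ st; split.
  by apply: lt_le_trans lams _; nra.
have t0 : 0 <= (0 : R) <= t.
  by case/andP: st => s0 sT; rewrite lexx/= (le_trans s0 sT).
have [_] := xy _ t0; rewrite time_change0// => xy0.
have := xK _ st; have := xK _ t0; move: xys xy0.
rewrite !prod_normE/= !gt_max !ge_max.
move=> /andP[/andP[xs ys] zs] /andP[/andP[x0 y0] z0].
move=> /andP[/andP[xK0 yK0] _] /andP[/andP[xKs yKs] _].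
have KC : K <= C - 1 by rewrite addrK ler_norm.
have h1 : `|(y (lam s)).1.1 * (y (lam s)).1.2 - (x s).1.1 * (x s).1.2| <= 2 * (dl * C).
  by apply: mulr_dist; rewrite // ?(le_trans _ KC)// ltW.
have h2 : `|(y 0).1.1 * (y 0).1.2 - (x 0).1.1 * (x 0).1.2| <= 2 * (dl * C).
  by apply: mulr_dist; rewrite // ?(le_trans _ KC)// ltW.
have dC : dl <= dl * C by rewrite ler_peMr// ltW.
have de : dl <= e by rewrite (le_trans dC)// (le_trans dle)//; lra.
rewrite (lt_le_trans xs de) (lt_le_trans ys de)/=.
have {zs} := ltW zs; rewrite ler_norml => /andP[zs zs'].
move: h1 h2; rewrite !ler_norml ltr_norml => /andP[h1 h1'] /andP[h2 h2'].
by apply/andP; split; lra.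
Qed.
End paths.

(** * Convergence in probability and tightness *)

Section convergence_in_probability.
Context {R : realType} {d : measure_display} {T : measurableType d}.
Variable P : probability T R.

Lemma measurable_ge (f : T -> R) (c : R) : measurable_fun [set: T] f ->
  measurable [set w | c <= f w].
Proof.
move=> mf; rewrite -[X in measurable X]setTI.
by apply: measurable_fun_le => //; exact: measurable_cst.
Qed.

Lemma le_prob_ae (A B : set T) : measurable A -> measurable B ->
  {ae P, forall w, A w -> B w} -> (P A <= P B)%E.
Proof.
move=> mA mB [N [mN N0 subN]].
have AB : A `<=` B `|` N.
  move=> w Aw; have [Bw|nBw] := pselect (B w); [by left|right].
  by apply: subN => /= /(_ Aw).
have -> : P B = (P B + P N)%E by rewrite [X in (_ + X)%E](_ : _ = 0%E) ?adde0.
apply: le_trans (measureU2 _ _ _) => //.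
by apply: le_measure; rewrite ?inE//; exact: measurableU.
Qed.

Lemma prob_cvg0P (A : nat -> set T) : (forall n, measurable (A n)) ->
  P (A n) @[n --> \oo] --> 0%E <->
  forall e : R, 0 < e -> \forall n \near \oo, (P (A n) <= e%:E)%E.
Proof.
move=> mA; split=> [PA e e0|PA].
  have e0' : (0 < e%:E)%E by rewrite lte_fin.
  have {}PA : \forall n \near \oo, (P (A n) < e%:E)%E := PA _ (open_ereal_lt' e0').
  by apply: filterS PA => n /ltW.
apply/fine_cvgP; split.
  by apply: nearW => n; exact: fin_num_measure.
apply/cvgrPdist_le => e e0; apply: filterS (PA _ e0) => n PAe.
rewrite sub0r normrN ger0_norm ?fine_ge0// -lee_fin fineK//.
exact: fin_num_measure.
Qed.

(** Continuity from above, the intersection of the events being null. *)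
Lemma ae_nonincreasing_prob (E : nat -> set T) (e : R) :
  (forall n, measurable (E n)) -> (forall n m, (n <= m)%N -> E m `<=` E n) ->
  {ae P, forall w, exists n, ~ E n w} -> 0 < e ->
  exists n, (P (E n) <= e%:E)%E.
Proof.
move=> mE niE aeE e0.
have mcap : measurable (\bigcap_n E n) by exact: bigcapT_measurable.
have cap0 : P (\bigcap_n E n) = 0%E.
  apply/eqP; rewrite -measure_le0 -(measure0 P).
  apply: le_prob_ae => //; case: aeE => N [mN N0 subN]; exists N; split => //.
  move=> w /= nw; apply: subN => /= -[n nEw]; apply: nw => /(_ n I) //.
have : P \o E @ \oo --> 0%E.
  rewrite -cap0; apply: nonincreasing_cvg_mu => //.
    by rewrite -ge0_fin_numE// fin_num_measure.
  by move=> n m /niE; rewrite subsetEset.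
by move=> /prob_cvg0P - /(_ mE e e0) [n _ /(_ n (leqnn n))] ?; exists n.
Qed.

(** Only upper tails are controlled: the definition serves for nonnegative quantities, sums of
    squares and maxima. *)
Definition tight (Y : nat -> T -> R) :=
  forall e : R, 0 < e -> exists2 K : R, 0 < K &
    forall l, (P [set w | (K <= Y l w)%R] <= e%:E)%E.

Lemma tight_ae_bounded (Y : nat -> T -> R) :
  (forall l, measurable_fun [set: T] (Y l)) ->
  {ae P, forall w, exists K : R, forall l, Y l w <= K} -> tight Y.
Proof.
move=> mY aeY e e0.
have mYK l k : measurable [set w | k%:R <= Y l w] by exact: measurable_ge.
(* The level [k.+1] makes the resulting bound strictly positive, even for [k = 0]. *)
pose E k := \bigcup_l [set w | k.+1%:R <= Y l w].
have [|k m km|||k PEk] := @ae_nonincreasing_prob E e.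
- by move=> k; apply: bigcupT_measurable => l.
- move=> w [l _ /= Yl]; exists l => //=; apply: le_trans Yl.
  by rewrite ler_nat.
- apply: filterS aeY => w [K YK]; exists (Num.truncn `|K|) => -[l _ /=].
  apply/negP; rewrite -ltNge (le_lt_trans (YK l))//.
  by rewrite (le_lt_trans (ler_norm K))// truncnS_gt.
- exact: e0.
exists k.+1%:R => [|l]; first by rewrite ltr0n.
apply: le_trans PEk; apply: le_measure; rewrite ?inE//.
  by apply: bigcupT_measurable => l'.
by move=> w Yw; exists l.
Qed.

Lemma tightD (Y Y' : nat -> T -> R) :
  (forall l, measurable_fun [set: T] (Y l)) ->
  (forall l, measurable_fun [set: T] (Y' l)) ->
  tight Y -> tight Y' -> tight (fun l w => Y l w + Y' l w).
Proof.
move=> mY mY' tY tY' e e0.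
have e20 : 0 < e / 2 by rewrite divr_gt0.
have [[K K0 YK] [K' K'0 YK']] := (tY _ e20, tY' _ e20).
exists (K + K') => [|l]; first by rewrite addr_gt0.
rewrite (splitr e) EFinD; apply: le_trans (leeD (YK l) (YK' l)).
apply: le_trans (measureU2 _ _ _); try exact: measurable_ge.
apply: le_measure; rewrite ?inE//; try exact: measurable_ge.
- by apply: measurable_ge; exact: measurable_funD.
- by apply: measurableU; exact: measurable_ge.
move=> w /= KY; have [|YK1] := leP K (Y l w); [by left|right].
by rewrite /=; lra.
Qed.

Lemma tight_ae_le (Y Y' : nat -> T -> R) :
  (forall l, measurable_fun [set: T] (Y l)) ->
  (forall l, measurable_fun [set: T] (Y' l)) ->
  {ae P, forall w l, Y l w <= Y' l w} -> tight Y' -> tight Y.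
Proof.
move=> mY mY' YY' tY' e e0; have [K K0 YK] := tY' _ e0.
exists K => // l; apply: le_trans (YK l).
apply: le_prob_ae; try exact: measurable_ge.
by apply: filterS YY' => w /(_ l) YY' KY /=; exact: le_trans YY'.
Qed.

(** The event that some term of index at least [k] is still off by [c] decreases to a null event. *)
Lemma ae_cvg_in_probability (Y : nat -> T -> R) :
  (forall l, measurable_fun [set: T] (Y l)) ->
  {ae P, forall w, Y l w @[l --> \oo] --> (0 : R)} ->
  cvg_in_probability P Y (cst 0).
Proof.
move=> mY aeY c c0.
have mYc l : measurable [set w | c <= `|Y l w - 0|].
  by under eq_set do rewrite subr0; apply: measurable_ge; exact: measurableT_comp.
apply/prob_cvg0P => // e e0.
pose E k := \bigcup_(l in [set l | (k <= l)%N]) [set w | c <= `|Y l w - 0|].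
have mE k : measurable (E k).
  by apply: bigcup_measurable => l _.
have [//|k m km|||k PEk] := @ae_nonincreasing_prob E e.
- by move=> w [l /= ml Yl]; exists l => //=; exact: leq_trans ml.
- apply: filterS aeY => w /cvgrPdist_lt/(_ _ c0)[k _ Yk]; exists k => -[l /= kl].
  by apply/negP; rewrite -ltNge distrC; exact: Yk.
- exact: e0.
exists k => // l /= kl; apply: le_trans PEk.
by apply: le_measure; rewrite ?inE// => w Yw; exists l.
Qed.

End convergence_in_probability.

(** * Sums along subdivisions, and the Huber function *)

Section subdivisions.
Context {R : realType}.
Implicit Types (t : R) (s : seq R) (f g : R -> R).

Definition qv_sum t s f : R :=
  \sum_(i < size s) (f (nth t (0 :: s) i.+1) - f (nth t (0 :: s) i)) ^+ 2.

Definition covariation_sum t s f g : R :=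
  \sum_(i < size s) (f (nth t (0 :: s) i.+1) - f (nth t (0 :: s) i)) *
                    (g (nth t (0 :: s) i.+1) - g (nth t (0 :: s) i)).

(** Valid for every index, because the default value of [nth] is the endpoint [t]; the same
    convention makes the next lemma hold past the end of the list. *)
Lemma itv_partition_nth_itv t s i : itv_partition 0 t s ->
  0 <= nth t (0 :: s) i <= t.
Proof.
move=> st; have [si|si] := ltnP i (size s).+1.
  by rewrite itv_partition_nth_ge// itv_partition_nth_le.
by rewrite nth_default//= lexx andbT; exact: itv_partition_le st.
Qed.

Lemma itv_partition_nth_leS t s i : itv_partition 0 t s ->
  nth t (0 :: s) i <= nth t (0 :: s) i.+1.
Proof.
move=> st; have [si|si] := ltnP i (size s).
  exact: (@nondecreasing_fun_itv_partition _ _ 0 t id s _ st i si).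
by rewrite [leRHS]nth_default//; case/andP: (itv_partition_nth_itv i st).
Qed.

Lemma sum_increments t s f : itv_partition 0 t s ->
  \sum_(i < size s) (f (nth t (0 :: s) i.+1) - f (nth t (0 :: s) i)) =
  f t - f 0.
Proof.
move=> st; rewrite -(big_mkord xpredT (fun i => f (nth t (0 :: s) i.+1) -
  f (nth t (0 :: s) i))).
rewrite (telescope_sumr (fun i => f (nth t (0 :: s) i)))//.
by rewrite (itv_partition_nth_size _ st).
Qed.

(** On each interval the three summands add up to the increment of the product, and these increments
    telescope. *)
Lemma stieltjes_sum_by_parts t s f g : itv_partition 0 t s ->
  stieltjes_sum t s f g + stieltjes_sum t s g f + covariation_sum t s f g =
  f t * g t - f 0 * g 0.
Proof.
move=> st; rewrite -(sum_increments (fun u => f u * g u) st) -!big_split /=.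
by apply: eq_bigr => i _; ring.
Qed.

(** Young's inequality term by term. The free weight [c] later balances a tight sum against a
    vanishing one. *)
Lemma covariation_sum_le t s f g (c : R) : 0 < c ->
  2 * `|covariation_sum t s f g| <= c * qv_sum t s f + c^-1 * qv_sum t s g.
Proof.
move=> c0; rewrite !mulr_sumr -big_split/=.
apply: le_trans (ler_wpM2l _ (ler_norm_sum _ _ _)) _ => //.
rewrite mulr_sumr; apply: ler_sum => i _; rewrite normrM.
set a := f _ - f _; set b := g _ - g _.
rewrite -(real_normK (num_real a)) -(real_normK (num_real b)).
have : 0 <= (c * `|a| - `|b|) ^+ 2 * c^-1.
  by rewrite mulr_ge0 ?sqr_ge0// invr_ge0 ltW.
have cV : c * c^-1 = 1 by rewrite mulfV// gt_eqF.
have -> : (c * `|a| - `|b|) ^+ 2 * c^-1 =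
  (c * c^-1) * c * `|a| ^+ 2 - (c * c^-1) * 2 * (`|a| * `|b|) + c^-1 * `|b| ^+ 2.
  by ring.
by rewrite cV; lra.
Qed.

Lemma qv_sum_ge0 t s f : 0 <= qv_sum t s f.
Proof. by apply: sumr_ge0 => i _; exact: sqr_ge0. Qed.

Lemma qv_sumD_le t s f g :
  qv_sum t s (fun u => f u + g u) <= 2 * qv_sum t s f + 2 * qv_sum t s g.
Proof.
rewrite !mulr_sumr -big_split/=; apply: ler_sum => i _.
set a := f _; set b := f _; set a' := g _; set b' := g _.
have := sqr_ge0 (a - b - (a' - b')); lra.
Qed.

(** The squares are the diagonal terms of the expanded square of the variation, whose other terms
    are nonnegative. *)
Lemma qv_sum_le_variation t s f : qv_sum t s f <= variation 0 t f s ^+ 2.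
Proof.
rewrite /qv_sum /variation big_mkord expr2 big_distrlr/=.
apply: ler_sum => i _; rewrite (bigD1 i)//=.
rewrite -(real_normK (num_real (_ - _))) expr2 lerDl.
by apply: sumr_ge0 => j _; rewrite mulr_ge0.
Qed.

(** The sum counts the positive integers up to [v], so it is the integer part of [v]. Written with
    threshold indicators, it approximates a variable within 1, whatever the size of [m]. *)
Lemma staircase_approx (m : nat) (v : R) : 0 <= v <= m%:R ->
  \sum_(j < m) (j.+1%:R <= v)%R%:R <= v <= \sum_(j < m) (j.+1%:R <= v)%R%:R + 1.
Proof.
elim: m v => [|m IH] v /andP[v0 vm].
  by rewrite big_ord0 v0 (le_trans vm)// addr_ge0.
rewrite big_ord_recr/=; have [vm'|mv] := leP v m%:R.
  rewrite [(m.+1%:R <= v)]lt_geF ?(le_lt_trans vm') ?ltr_nat//= addr0.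
  by apply: IH; rewrite v0.
have -> : \sum_(j < m) (j.+1%:R <= v)%R%:R = m%:R :> R.
  rewrite (eq_bigr (fun=> 1)) => [|j _].
    by rewrite sumr_const card_ord.
  by rewrite (le_trans _ (ltW mv))// ler_nat.
have [mv'|_] /= := leP m.+1%:R v; move: vm; rewrite ?addr0 -natr1 => vm.
  by move: mv'; rewrite -natr1 => mv'; apply/andP; split; lra.
by apply/andP; split; [exact: ltW|].
Qed.

Definition clampr (b x : R) : R := Num.max (- b) (Num.min x b).

(** For [0 <= b], this is half the square of [x] on [-b, b], continued outside by its tangent lines
    of slopes [b] and [- b]; [clampr] spares the case distinction. *)
Definition huber (b x : R) : R := clampr b x * x - clampr b x ^+ 2 / 2.

Lemma clampr_le b x : 0 <= b -> `|clampr b x| <= b.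
Proof.
by move=> b0; rewrite /clampr; case: (leP x b) => xb; case: (leP (- b) _) => bx;
   rewrite ler_norml; apply/andP; split; lra.
Qed.

(** The left side is concave in the slope [c], with constrained maximum at the projection of [y]
    onto [-b, b]. The gap is half a square, plus a product of two factors of the same sign when [y]
    lies outside. *)
Lemma huber_max b c y : `|c| <= b -> c * y - c ^+ 2 / 2 <= huber b y.
Proof.
rewrite ler_norml /huber /clampr => /andP[bc cb].
case: (leP y b) => yb; last first.
  rewrite max_r; last lra.
  have : 0 <= (b - c) * (y - b) by rewrite mulr_ge0; lra.
  have := sqr_ge0 (b - c); rewrite !expr2; lra.
case: (leP (- b) _) => bx.
  by have := sqr_ge0 (y - c); rewrite !expr2; lra.
have : 0 <= (c + b) * (- b - y) by apply: mulr_ge0; lra.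
have := sqr_ge0 (b + c); rewrite !expr2; lra.
Qed.

(* As a maximum of affine functions, attained for the slope [clampr b x], huber
   is convex with derivative clampr. *)
Lemma huber_convex b x y : 0 <= b ->
  0 <= huber b y - huber b x - clampr b x * (y - x).
Proof.
by move=> b0; have := huber_max y (clampr_le x b0); rewrite /huber; lra.
Qed.

Lemma huber_quadratic b x y : `|x| <= b -> `|y| <= b ->
  huber b y - huber b x - clampr b x * (y - x) = (y - x) ^+ 2 / 2.
Proof.
rewrite !ler_norml => /andP[bx xb] /andP[by_ yb].
by rewrite /huber /clampr !min_l// !max_r//; field.
Qed.

Lemma huber0 b : 0 <= b -> huber b 0 = 0.
Proof.
by move=> b0; rewrite /huber /clampr min_l// max_r ?oppr_le0// !mul0r expr0n/= mul0r subr0.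
Qed.

(** The lower bound is convexity at 0, where value and slope vanish. The linear upper bound makes
    the function of an integrable variable integrable. *)
Lemma huber_bound b x : 0 <= b -> 0 <= huber b x <= b * `|x|.
Proof.
move=> b0; apply/andP; split.
  have := huber_convex 0 x b0; rewrite huber0// subr0.
  by rewrite /clampr min_l// max_r ?oppr_le0// mul0r subr0.
rewrite /huber; apply: (@le_trans _ _ (clampr b x * x)).
  by rewrite lerBlDr lerDl divr_ge0// sqr_ge0.
rewrite (le_trans (ler_norm _))// normrM ler_wpM2r//; exact: clampr_le.
Qed.

End subdivisions.

(** * Real-valued integrals: domination, finite sums, Markov's inequality *)

Section real_integrals.
Context {R : realType} {d : measure_display} {T : measurableType d}.
Variable P : probability T R.
Implicit Types f g h : T -> R.

Notation integrableR f := (P.-integrable [set: T] (EFin \o f)).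

Lemma measurable_bigmax n (h : 'I_n -> T -> R) :
  (forall i, measurable_fun [set: T] (h i)) ->
  measurable_fun [set: T] (fun w => \big[Num.max/0]_(i < n) h i w).
Proof.
move=> mh; elim: (index_enum _) => [|i r IH].
  by under eq_fun do rewrite big_nil; exact: measurable_cst.
by under eq_fun do rewrite big_cons; exact: measurable_maxr.
Qed.

Lemma integrable_le f g : measurable_fun [set: T] f -> integrableR g ->
  (forall w, `|f w| <= g w) -> integrableR f.
Proof.
move=> mf ig fg; apply: le_integrable ig => //; first exact/measurable_EFinP.
by move=> w _ /=; rewrite lee_fin (le_trans (fg w))// ler_norm.
Qed.

Lemma integrable_mulr_bounded h f (c : R) : measurable_fun [set: T] h ->
  (forall w, `|h w| <= c) -> integrableR f -> integrableR (fun w => h w * f w).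
Proof.
move=> mh hc intf; have mf : measurable_fun [set: T] f.
  by apply/measurable_EFinP; exact: measurable_int intf.
apply: (@integrable_le _ (fun w => c * `|f w|)).
- exact: measurable_funM.
- exact: integrableZl (integrable_abse intf).
by move=> w; rewrite normrM ler_wpM2r.
Qed.

Lemma integrable_sumR n (f : nat -> T -> R) :
  (forall i, (i < n)%N -> integrableR (f i)) ->
  integrableR (fun w => \sum_(i < n) f i w).
Proof.
elim: n => [|n IH] intf.
  by under eq_fun do rewrite big_ord0; exact: finite_measure_integrable_cst.
under eq_fun do rewrite big_ord_recr/=.
have intn : integrableR (fun w => \sum_(i < n) f i w).
  by apply: IH => i ni; apply: intf; exact: ltnW.
exact: (integrableD measurableT intn (intf n (ltnSn n))).
Qed.

Lemma Rintegral_sum n (f : nat -> T -> R) :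
  (forall i, (i < n)%N -> integrableR (f i)) ->
  \int[P]_(w in [set: T]) (\sum_(i < n) f i w) =
  \sum_(i < n) \int[P]_(w in [set: T]) f i w.
Proof.
elim: n => [|n IH] intf.
  by under eq_Rintegral do rewrite big_ord0; rewrite big_ord0 Rintegral_cst// mul0r.
under eq_Rintegral do rewrite big_ord_recr/=.
have intf' i : (i < n)%N -> integrableR (f i) by move=> ni; apply: intf; exact: ltnW.
rewrite RintegralD//; last 2 first.
- exact: integrable_sumR.
- exact: intf.
by rewrite IH// big_ord_recr.
Qed.

Lemma markov_Rintegral f (c : R) : (forall w, 0 <= f w) -> integrableR f ->
  0 < c -> (P [set w | (c <= f w)%R] <= (\int[P]_(w in [set: T]) f w / c)%:E)%E.
Proof.
move=> f0 intf c0; set A := [set w | _].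
have mA : measurable A.
  apply: measurable_ge; apply/measurable_EFinP; exact: measurable_int intf.
have PA : P A \is a fin_num by exact: fin_num_measure.
have intA : integrableR (\1_A : T -> R) by exact: integrable_indic.
rewrite -(fineK PA) lee_fin ler_pdivlMr//.
have -> : fine (P A) = \int[P]_(w in [set: T]) \1_A w.
  by rewrite /Rintegral integral_indic// setIT.
rewrite -RintegralZr//; apply: le_Rintegral => //.
  exact: (integrableZr measurableT c intA).
move=> w _; rewrite indicE; have [|_] := boolP (w \in A).
  by rewrite inE mul1r.
by rewrite mul0r.
Qed.

End real_integrals.

(** * Orthogonality of martingale increments to bounded variables of the past *)

Section martingales.
Context {R : realType} {d : measure_display} {T : measurableType d}.
Variable P : probability T R.

Notation integrableR f := (P.-integrable [set: T] (EFin \o f)).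

Section orthogonality.
Variables (G : set (set T)) (D : T -> R).
Hypotheses (GT : G [set: T]) (subG : G `<=` measurable).
Hypothesis intD : integrableR D.
Hypothesis GD : forall A, G A -> \int[P]_(w in A) D w = 0.

Lemma sub_measurable_fun (g : T -> R) :
  sub_measurable G g -> measurable_fun [set: T] g.
Proof. by move=> gG _ C mC; rewrite setTI; apply: subG; exact: gG. Qed.

Lemma sub_measurable_comp (h : R -> R) (g : T -> R) :
  measurable_fun [set: R] h -> sub_measurable G g -> sub_measurable G (h \o g).
Proof.
move=> mh gG C mC; rewrite comp_preimage; apply: gG.
by rewrite -[X in measurable X]setTI; exact: mh.
Qed.

(** The staircase below [v] is a sum of indicators of events of [G], hence orthogonal to [D], and
    what remains of [v] lies between 0 and 1. The bound is independent of [m]. *)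
Lemma Rintegral_staircase (v : T -> R) (m : nat) : sub_measurable G v ->
  (forall w, 0 <= v w <= m%:R) ->
  `|\int[P]_(w in [set: T]) (v w * D w)| <= \int[P]_(w in [set: T]) `|D w|.
Proof.
move=> vG vm; have mv := sub_measurable_fun vG.
pose A j := [set w | j.+1%:R <= v w].
have GA j : G (A j).
  rewrite (_ : A j = v @^-1` `[j.+1%:R, +oo[); first exact: vG.
  by apply/seteqP; split=> w /=; rewrite in_itv/= andbT.
pose step w : R := \sum_(j < m) \1_(A j) w.
have mA j : measurable_fun [set: T] (\1_(A j) : T -> R).
  by apply: measurable_indic; exact: subG.
have stepv w : step w <= v w <= step w + 1.
  have := staircase_approx (vm w); rewrite /step.
  under [X in _ -> X <= _ <= X + 1]eq_bigr => j _.
    rewrite indicE mem_setE.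
  over.
  by [].
have intAD j : integrableR (fun w => \1_(A j) w * D w).
  apply: (integrable_mulr_bounded (c := 1)) => // w.
  by rewrite indicE; case: (_ \in _); rewrite ?normr1 ?normr0.
have step0 : \int[P]_(w in [set: T]) (step w * D w) = 0.
  under eq_Rintegral do rewrite mulr_suml.
  rewrite (Rintegral_sum (f := fun j w => \1_(A j) w * D w)) => [|j _//].
  apply: big1 => j _; rewrite -[RHS](GD (GA j)) [RHS]Rintegral_mkcond.
  apply: eq_Rintegral => w _; rewrite patchE indicE.
  by case: ifP; rewrite ?mul1r ?mul0r.
have intstep : integrableR (fun w => step w * D w).
  have := integrable_sumR (n := m) (fun j _ => intAD j).
  by under eq_fun do rewrite -mulr_suml.
have intv : integrableR (fun w => v w * D w).
  apply: (integrable_mulr_bounded (c := m%:R)) => // w.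
  by case/andP: (vm w) => ? ?; rewrite ger0_norm.
rewrite -[X in `|X|]subr0 -step0 -RintegralB//.
have intB := integrableB measurableT intv intstep.
apply: le_trans (le_normr_Rintegral _ _) _ => //.
apply: le_Rintegral => //.
- exact: (integrable_abse intB).
- exact: (integrable_abse intD).
move=> w _; rewrite -mulrBl normrM ler_piMl//.
by case/andP: (stepv w) => ? ?; rewrite ger0_norm ?subr_ge0// lerBlDl.
Qed.

(** A scaling argument: the staircase bound ignores the size of the factor, so it applies to
    arbitrarily large multiples of [g] and forces the integral to vanish. *)
Lemma Rintegral_bounded_orthogonal (g : T -> R) (c : R) : sub_measurable G g ->
  (forall w, `|g w| <= c) -> \int[P]_(w in [set: T]) (g w * D w) = 0.
Proof.
move=> gG gc; have mg := sub_measurable_fun gG.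
have intg : integrableR (fun w => g w * D w).
  by apply: (integrable_mulr_bounded (c := c)).
set I := LHS; set M := \int[P]_(w in [set: T]) `|D w|.
have bound (n : nat) : n%:R * `|I| <= M.
  (* The shift by [c] makes the factor nonnegative; it leaves the integral unchanged because [D] has
     mean zero. *)
  pose v w := n%:R * (g w + c).
  have vG : sub_measurable G v.
    apply: (sub_measurable_comp (h := fun x => n%:R * (x + c))) => //.
    by apply: measurable_funM => //; exact: measurable_funD.
  have vb w : 0 <= v w <= (Num.truncn (n%:R * (c + c))).+1%:R.
    have := gc w; rewrite ler_norml => /andP[gl gr].
    rewrite mulr_ge0//=; last by rewrite -lerBlDr sub0r.
    by rewrite (le_trans _ (ltW (truncnS_gt _)))// ler_wpM2l// lerD2r.
  have := Rintegral_staircase vG vb.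
  have -> : \int[P]_(w in [set: T]) (v w * D w) = n%:R * I.
    under eq_Rintegral => w _.
      rewrite (_ : v w * D w = n%:R * (g w * D w) + (n%:R * c) * D w); last first.
        by rewrite /v; ring.
    over.
    rewrite RintegralD//; last 2 first.
    - exact: (integrableZl measurableT n%:R intg).
    - exact: (integrableZl measurableT (n%:R * c) intD).
    by rewrite !RintegralZl// (GD GT) mulr0 addr0.
  by rewrite normrM ger0_norm.
apply/eqP; rewrite -normr_le0 leNgt; apply/negP => I0.
(* This multiple exceeds [M / |I|], which contradicts [bound]. *)
have := bound (Num.truncn (M / `|I|)).+1.
by apply/negP; rewrite -ltNge -ltr_pdivrMr// truncnS_gt.
Qed.

End orthogonality.

Lemma martingale_orthogonal (F : R -> set (set T)) (X : T -> R -> R)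
    (s t b : R) : filtration F -> martingale P F X -> 0 <= s -> s <= t -> 0 <= b ->
  \int[P]_(w in [set: T]) (clampr b (X w s) * (X w t - X w s)) = 0.
Proof.
move=> [Fs Fmono] [adX intX condX] s0 st b0.
have [sigF subF] := Fs _ s0; have t0 := le_trans s0 st.
have intt := intX _ t0; have ints := intX _ s0.
have FT : F s [set: T].
  by have [F0 FC _] := sigF; have := FC _ F0; rewrite setD0.
have intB : integrableR (fun w => X w t - X w s) by
  exact: (integrableB measurableT intt ints).
apply: (Rintegral_bounded_orthogonal FT subF intB).
- move=> A FA; have mA := subF _ FA.
  rewrite RintegralB//; last 2 first.
  + exact: integrableS intt.
  + exact: integrableS ints.
  have [_ _ /(_ _ FA) XA] := condX _ _ s0 st.
  by rewrite /Rintegral XA subrr.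
- apply: (sub_measurable_comp (h := clampr b)); last exact: adX.
  by apply: measurable_maxr => //; exact: measurable_minr.
- by move=> w; exact: clampr_le.
Qed.

End martingales.

(** * Tightness of the sums of squared increments of a semimartingale *)

Section quadratic_variation.
Context {R : realType} {d : measure_display} {T : measurableType d}.
Variables (P : probability T R) (F : R -> set (set T)).
Hypothesis filtF : filtration F.

Notation integrableR f := (P.-integrable [set: T] (EFin \o f)).

Lemma measurable_covariation_sum (X Y : T -> R -> R) (t : R) (s : seq R) :
  (forall u, 0 <= u -> measurable_fun [set: T] (fun w => X w u)) ->
  (forall u, 0 <= u -> measurable_fun [set: T] (fun w => Y w u)) ->
  itv_partition 0 t s ->
  measurable_fun [set: T] (fun w => covariation_sum t s (X w) (Y w)).
Proof.
move=> mX mY st; apply: measurable_sum => i.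
have u0 j : 0 <= nth t (0 :: s) j by case/andP: (itv_partition_nth_itv j st).
by apply: measurable_funM; apply: measurable_funB; auto.
Qed.

Lemma qv_sumE t s (f : R -> R) : qv_sum t s f = covariation_sum t s f f.
Proof. by apply: eq_bigr => i _; rewrite expr2. Qed.

Lemma measurable_qv_sum (X : T -> R -> R) (t : R) (s : seq R) :
  (forall u, 0 <= u -> measurable_fun [set: T] (fun w => X w u)) ->
  itv_partition 0 t s -> measurable_fun [set: T] (fun w => qv_sum t s (X w)).
Proof.
move=> mX st; under eq_fun do rewrite qv_sumE.
exact: measurable_covariation_sum.
Qed.

Lemma adapted_measurable (X : T -> R -> R) :
  (forall t, 0 <= t -> sub_measurable (F t) (fun w => X w t)) ->
  forall t, 0 <= t -> measurable_fun [set: T] (fun w => X w t).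
Proof.
have [Fs _] := filtF.
by move=> aX t t0; apply: sub_measurable_fun (aX _ t0); have [] := Fs _ t0.
Qed.

(* The sum of the excesses of the Huber function along the subdivision has
   expectation [E huber b (X t)], and it equals half the sum of squares as long
   as [X] stays in [-b, b]: a weak type estimate which only needs
   integrability, not square integrability. *)
Lemma martingale_qv_tail (X : T -> R -> R) (t b c : R) (s : seq R) :
  martingale P F X -> (forall w, X w 0 = 0) -> itv_partition 0 t s ->
  0 < b -> 0 < c ->
  (P [set w | (c <= qv_sum t s (X w))%R] <=
   P [set w | (b <= \big[Num.max/0]_(i < (size s).+1) `|X w (nth t (0 :: s) i)|)%R] +
   (2 * b * (\int[P]_(w in [set: T]) `|X w t|) / c)%:E)%E.
Proof.
move=> mart X0 st b0 c0; have [adX intX _] := mart.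
have mX := adapted_measurable adX.
have b0' := ltW b0; have t0 : 0 <= t by exact: itv_partition_le st.
pose p i := nth t (0 :: s) i.
have p0 i : 0 <= p i by case/andP: (itv_partition_nth_itv i st).
pose h i w := huber b (X w (p i)).
pose m i w := clampr b (X w (p i)) * (X w (p i.+1) - X w (p i)).
(* Excess of the Huber function over its tangent: the [h] part telescopes and the [m] part has mean
   zero by orthogonality. *)
pose D i w := h i.+1 w - h i w - m i w.
have mclampr u : 0 <= u -> measurable_fun [set: T] (fun w => clampr b (X w u)).
  by move=> u0; apply: measurable_maxr => //; apply: measurable_minr => //; exact: mX.
have inth i : integrableR (h i).
  apply: (integrable_le (g := fun w => b * `|X w (p i)|)).
  - apply: measurable_funB.
      by apply: measurable_funM; [exact: mclampr|exact: mX].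
    apply: measurable_funM => //; apply: measurable_funX; exact: mclampr.
  - exact: (integrableZl measurableT b (integrable_abse (intX _ (p0 i)))).
  - move=> w; have /andP[h0 hb] := huber_bound (X w (p i)) b0'.
    by rewrite /h ger0_norm.
have intm i : integrableR (m i).
  apply: (integrable_mulr_bounded (c := b)); first exact: mclampr.
    by move=> w; exact: clampr_le.
  exact: (integrableB measurableT (intX _ (p0 i.+1)) (intX _ (p0 i))).
have inthh i : integrableR (fun w => h i.+1 w - h i w).
  exact: (integrableB measurableT (inth i.+1) (inth i)).
have intD i : integrableR (D i).
  exact: (integrableB measurableT (inthh i) (intm i)).
have m0 i : \int[P]_(w in [set: T]) m i w = 0.
  by apply: (martingale_orthogonal filtF mart) => //; exact: itv_partition_nth_leS.
pose Q w := \sum_(i < size s) D i w.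
have intQ : integrableR Q by exact: integrable_sumR.
have Q0 w : 0 <= Q w by apply: sumr_ge0 => i _; exact: huber_convex.
have intQE : \int[P]_(w in [set: T]) Q w <= b * \int[P]_(w in [set: T]) `|X w t|.
  have intXt : integrableR (fun w => `|X w t|) by exact: (integrable_abse (intX _ t0)).
  rewrite (Rintegral_sum (f := D))// -RintegralZl//.
  have -> : \sum_(i < size s) \int[P]_(w in [set: T]) D i w =
            \int[P]_(w in [set: T]) h (size s) w.
    have int0 : \int[P]_(w in [set: T]) h 0 w = 0.
      under eq_Rintegral do rewrite /h /p/= X0 huber0//.
      by rewrite Rintegral_cst// mul0r.
    have -> : \int[P]_(w in [set: T]) h (size s) w =
      \int[P]_(w in [set: T]) h (size s) w - \int[P]_(w in [set: T]) h 0 w.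
      by rewrite int0 subr0.
    rewrite -(telescope_sumr (fun i => \int[P]_(w in [set: T]) h i w))//.
    rewrite big_mkord; apply: eq_bigr => i _.
    by rewrite RintegralB// m0 subr0 RintegralB.
  apply: le_Rintegral => //.
    exact: (integrableZl measurableT b intXt).
  move=> w _; rewrite /h /p (itv_partition_nth_size _ st).
  by case/andP: (huber_bound (X w t) b0').
pose Y w := \big[Num.max/0]_(i < (size s).+1) `|X w (p i)|.
have mY : measurable_fun [set: T] Y.
  apply: (measurable_bigmax (h := fun i w => `|X w (p i)|)) => i.
  by apply: measurableT_comp => //; exact: mX.
have mQ : measurable_fun [set: T] Q.
  by apply/measurable_EFinP; exact: measurable_int intQ.
(* Markov's inequality at [c / 2], because [Q] is only half the sum of squares; hence the factor 2
   in the bound. *)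
have Qc : (P [set w | (c / 2 <= Q w)%R] <=
    (2 * b * (\int[P]_(w in [set: T]) `|X w t|) / c)%:E)%E.
  apply: le_trans (markov_Rintegral Q0 intQ _) _; first by rewrite divr_gt0.
  rewrite lee_fin invf_div mulrA ler_pM2r ?invr_gt0// mulrC -mulrA.
  by rewrite ler_pM2l.
apply: le_trans (leeD (lexx _) Qc).
apply: le_trans (measureU2 _ _ _); try exact: measurable_ge.
apply: le_measure; rewrite ?inE.
- by apply: measurable_ge; exact: measurable_qv_sum.
- by apply: measurableU; exact: measurable_ge.
(* Either the path reaches [b] at some subdivision point, or all these values stay in the quadratic
   zone and [Q] is exactly half the sum of squares. *)
move=> w /= cq; have [|Yb] := leP b (Y w); [by left|right].
have Xb i : (i < (size s).+1)%N -> `|X w (p i)| <= b.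
  move=> si; apply: le_trans (ltW Yb).
  exact: (@le_bigmax _ _ _ 0 (fun i : 'I_(size s).+1 => `|X w (p i)|) (Ordinal si)).
rewrite /= (_ : Q w = qv_sum t s (X w) / 2) ?ler_pM2r ?invr_gt0//.
rewrite /Q /qv_sum mulr_suml; apply: eq_bigr => i _.
by apply: huber_quadratic; apply: Xb; rewrite ltnS// ltnW.
Qed.

(** First [b] is chosen so large that the maxima over all the subdivisions stay below it up to
    probability [e / 2]; then [c] makes the second term of the tail estimate at most [e / 2]. *)
Lemma martingale_qv_tight (X : T -> R -> R) (t : R) (s : nat -> seq R) :
  martingale P F X -> (forall w, X w 0 = 0) ->
  (forall w, exists K : R, forall u, 0 <= u <= t -> `|X w u| <= K) ->
  (forall l, itv_partition 0 t (s l)) ->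
  tight P (fun l w => qv_sum t (s l) (X w)).
Proof.
move=> mart X0 bX st e e0; have [adX _ _] := mart.
have mX := adapted_measurable adX.
pose Y l w := \big[Num.max/0]_(i < (size (s l)).+1) `|X w (nth t (0 :: s l) i)|.
have e20 : 0 < e / 2 by rewrite divr_gt0.
have [||b b0 Yb] := @tight_ae_bounded _ _ _ P Y _ _ _ e20.
- move=> l; apply: (measurable_bigmax (h := fun i w => `|X w (nth t (0 :: s l) i)|)) => i.
  apply: measurableT_comp => //; apply: mX.
  by case/andP: (itv_partition_nth_itv i (st l)).
- apply: nearW => w; have [K XK] := bX w; exists (Num.max 0 K) => l.
  apply: bigmax_le => [|i _]; first by rewrite le_max lexx.
  by rewrite le_max XK ?orbT//; exact: itv_partition_nth_itv.
set M := \int[P]_(w in [set: T]) `|X w t|.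
have M0 : 0 <= M by apply: Rintegral_ge0.
(* Solves [2 * b * M / c <= e / 2]; the added 1 keeps [c] positive when [M] is zero. *)
pose c := 4 * b * M / e + 1.
have c0 : 0 < c by rewrite ltr_wpDl// divr_ge0 ?(ltW e0)// !mulr_ge0// ltW.
exists c => // l; apply: le_trans (martingale_qv_tail mart X0 (st l) b0 c0) _.
rewrite (splitr e) EFinD; apply: leeD (Yb l) _.
rewrite lee_fin ler_pdivrMr// -/M /c mulrDr mulr1.
have -> : e / 2 * (4 * b * M / e) = 2 * b * M.
  by field; rewrite gt_eqF.
by rewrite lerDl ltW.
Qed.

(** Localization: off an event of probability at most [e / 2], the stopped path agrees with [M] on
    [0, t], and subtracting [M w 0] does not change increments. *)
Lemma local_martingale_qv_tight (M : T -> skorohod R) (t : R)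
    (s : nat -> seq R) : local_martingale P F M ->
  (forall l, itv_partition 0 t (s l)) ->
  tight P (fun l w => qv_sum t (s l) (M w)).
Proof.
move=> [adM [tau [stop mono tau_oo mart]]] st e e0.
have t0 : 0 <= t by exact: itv_partition_le (st 0).
have e20 : 0 < e / 2 by rewrite divr_gt0.
have [Fs _] := filtF.
pose E k := [set w | (tau k w <= t%:E)%E].
have mE k : measurable (E k).
  by have [_ subF] := Fs _ t0; apply: subF; have [_] := stop k; apply.
have [//|k l kl w|||k PE] := @ae_nonincreasing_prob _ _ _ P E (e / 2).
- exact: le_trans (mono _ _ _ kl).
- apply: filterS tau_oo => w /cvgeyPge/(_ (t + 1))[k _ tauk].
  exists k => /=; rewrite /E /= => /(le_trans (tauk _ (leqnn k))).
  by rewrite lee_fin gerDl ler10.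
- exact: e20.
have [tau0 _] := stop k.
pose X w u := stopped (tau k) M w u - M w 0.
(* A stopped path only takes values that [M] has taken earlier, so it inherits the bound on [0, t];
   an infinite stopping time gives [v = u]. *)
have stopE w u : 0 <= u -> exists2 v, 0 <= v <= u &
    stopped (tau k) M w u = M w v.
  move=> u0; exists (fine (Order.min u%:E (tau k w))) => //.
  have := tau0 w; case: (tau k w) => [r| |//]; rewrite ?lee_fin => r0.
    by rewrite -EFin_min/= le_min u0 r0 ge_min lexx.
  by rewrite min_l ?leey//= u0 lexx.
have bX w : exists K : R, forall u, 0 <= u <= t -> `|X w u| <= K.
  have [K MK] := cadlag_bounded t (skorohod_cadlag (M w)).
  exists (K + K) => u /andP[u0 ut]; rewrite /X; have [v /andP[v0 vu] ->] := stopE w u u0.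
  rewrite (le_trans (ler_normB _ _))// lerD// MK ?lexx//.
  by rewrite v0 (le_trans vu).
have X0 w : X w 0 = 0.
  rewrite /X; have [v v0 ->] := stopE w 0 (lexx _).
  by rewrite -eq_le in v0; rewrite -(eqP v0) subrr.
have [K K0 XK] := martingale_qv_tight (mart k) X0 bX st e20.
exists K => // l; rewrite (splitr e) EFinD.
apply: le_trans (leeD PE (XK l)).
have [adX _ _] := mart k.
have mXK : measurable [set w | K <= qv_sum t (s l) (X w)].
  by apply: measurable_ge; apply: measurable_qv_sum => //; exact: adapted_measurable.
apply: le_trans (measureU2 _ _ _) => //.
apply: le_measure; rewrite ?inE.
- apply: measurable_ge; apply: measurable_qv_sum => //.
  exact: adapted_measurable adM.
- exact: measurableU.
move=> w /= KM; have [|tauk] := leP (tau k w) t%:E; [by left|right].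
rewrite /= (_ : qv_sum _ _ _ = qv_sum t (s l) (M w))//.
have XE u : 0 <= u <= t -> stopped (tau k) M w u = M w u.
  move=> /andP[u0 ut]; rewrite /stopped min_l//=.
  by rewrite (le_trans _ (ltW tauk))// lee_fin.
apply: eq_bigr => i _;  rewrite !XE ?itv_partition_nth_itv//; congr (_ ^+ 2); ring.
Qed.

(** Almost surely, the squared total variation on [0, t] bounds the sums for all subdivisions at
    once. *)
Lemma finite_variation_qv_tight (A : T -> skorohod R) (t : R)
    (s : nat -> seq R) : adapted F A -> finite_variation P A ->
  (forall l, itv_partition 0 t (s l)) ->
  tight P (fun l w => qv_sum t (s l) (A w)).
Proof.
move=> adA fvA st; have t0 : 0 <= t by exact: itv_partition_le (st 0).
apply: tight_ae_bounded => [l|].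
  by apply: measurable_qv_sum => //; exact: adapted_measurable adA.
apply: filterS fvA => w /(_ _ t0)[K AK]; exists (K ^+ 2) => l.
apply: le_trans (qv_sum_le_variation _ _ _) _.
have V0 : 0 <= variation 0 t (A w) (s l) by exact: sumr_ge0.
have VK : variation 0 t (A w) (s l) <= K by apply: AK; exists (s l).
by rewrite ler_sqr// nnegrE (le_trans V0).
Qed.

Lemma semimartingale_qv_tight (X : T -> skorohod R) (t : R)
    (s : nat -> seq R) : semimartingale P F X ->
  (forall l, itv_partition 0 t (s l)) ->
  tight P (fun l w => qv_sum t (s l) (X w)).
Proof.
move=> [adX [M [A [lmM adA fvA XMA]]]] st.
have [adM _] := lmM.
have mqv (Y : T -> skorohod R) l : adapted F Y ->
    measurable_fun [set: T] (fun w => qv_sum t (s l) (Y w)).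
  by move=> adY; apply: measurable_qv_sum => //; exact: adapted_measurable adY.
have tM := local_martingale_qv_tight lmM st.
have tA := finite_variation_qv_tight adA fvA st.
have mMA l : measurable_fun [set: T]
    (fun w => qv_sum t (s l) (M w) + qv_sum t (s l) (A w)).
  by apply: measurable_funD; exact: mqv.
have tMA : tight P (fun l w => qv_sum t (s l) (M w) + qv_sum t (s l) (A w)).
  by apply: tightD => // l; exact: mqv.
(* The factor 2 of [qv_sumD_le] is obtained by adding the sum to itself, so that [tightD] is
   enough. *)
apply: (tight_ae_le _ _ _ (tightD mMA mMA tMA tMA)).
- by move=> l; exact: mqv.
- by move=> l; exact: measurable_funD.
apply: filterS XMA => w XMA l.
have -> : qv_sum t (s l) (X w) = qv_sum t (s l) (fun u => M w u + A w u).
  have u0 j : 0 <= nth t (0 :: s l) j.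
    by case/andP: (itv_partition_nth_itv j (st l)).
  by apply: eq_bigr => i _; rewrite !XMA.
by apply: le_trans (qv_sumD_le _ _ _ _) _; lra.
Qed.

End quadratic_variation.

(** * Integration by parts when the covariation vanishes *)

Section integration_by_parts.
Context {R : realType} {d : measure_display} {T : measurableType d}.
Variable P : probability T R.

(** Tightness keeps the squares of [X] below some [K] up to a small probability; the weighted
    inequality then leaves a multiple of the squares of [Y], which vanish. *)
Lemma covariation_cvg0 (X Y : T -> skorohod R) (t : R) (s : nat -> seq R) :
  process X -> process Y -> (forall l, itv_partition 0 t (s l)) ->
  tight P (fun l w => qv_sum t (s l) (X w)) ->
  cvg_in_probability P (fun l w => qv_sum t (s l) (Y w)) (cst 0) ->
  cvg_in_probability P (fun l w => covariation_sum t (s l) (X w) (Y w)) (cst 0).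
Proof.
move=> mX mY st tX cY e e0.
have mC l : measurable [set w | e <= `|covariation_sum t (s l) (X w) (Y w) - 0|].
  under eq_set do rewrite subr0.
  apply: measurable_ge; apply: measurableT_comp => //.
  exact: measurable_covariation_sum.
have mqX l c : measurable [set w | c <= qv_sum t (s l) (X w)].
  by apply: measurable_ge; exact: measurable_qv_sum.
have mqY l c : measurable [set w | c <= `|qv_sum t (s l) (Y w) - 0|].
  under eq_set do rewrite subr0.
  by apply: measurable_ge; apply: measurableT_comp => //; exact: measurable_qv_sum.
apply/prob_cvg0P => // r r0.
have r20 : 0 < r / 2 by rewrite divr_gt0.
have [K K0 XK] := tX _ r20.
(* With this weight both terms of [covariation_sum_le] are below [e] once the squares of [X] are
   below [K] and those of [Y] below [e * c]. *)
pose c := e / K; have c0 : 0 < c by rewrite divr_gt0.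
have ec0 : 0 < e * c by rewrite mulr_gt0.
have /prob_cvg0P - /(_ (fun l => mqY l _) _ r20) := cY _ ec0.
apply: filterS => l PY; rewrite (splitr r) EFinD.
apply: le_trans (leeD (XK l) PY).
apply: le_trans (measureU2 _ _ _) => //.
apply: le_measure; rewrite ?inE//; first exact: measurableU.
move=> w /=; rewrite subr0 => eC.
have [|XK'] := leP K (qv_sum t (s l) (X w)); [by left|right].
rewrite /= subr0 ger0_norm ?qv_sum_ge0// leNgt; apply/negP => Ye.
have := covariation_sum_le t (s l) (X w) (Y w) c0.
apply/negP; rewrite -ltNge.
have h1 : c * qv_sum t (s l) (X w) < e.
  by rewrite /c mulrAC ltr_pdivrMr// ltr_pM2l.
have h2 : c^-1 * qv_sum t (s l) (Y w) < e by rewrite mulrC ltr_pdivrMr.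
by move: h1 h2 eC; lra.
Qed.

Lemma measurable_stieltjes_sum (X Y : T -> skorohod R) (t : R) (s : seq R) :
  process X -> process Y -> itv_partition 0 t s ->
  measurable_fun [set: T] (fun w => stieltjes_sum t s (X w) (Y w)).
Proof.
move=> mX mY st; apply: measurable_sum => i.
have u0 j : 0 <= nth t (0 :: s) j by case/andP: (itv_partition_nth_itv j st).
by apply: measurable_funM; [|apply: measurable_funB]; auto.
Qed.

(** By the discrete identity, the error of the sums of [Y] against [X] is, up to sign, the error of
    those of [X] against [Y] plus the covariation sum; each is allowed [e / 2]. *)
Lemma stoch_integral_by_parts (X Y I : T -> skorohod R) :
  process X -> process Y ->
  (forall t s, 0 <= t -> fine_partitions t s -> cvg_in_probability P
     (fun l w => covariation_sum t (s l) (X w) (Y w)) (cst 0)) ->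
  stoch_integral P X Y I ->
  stoch_integral P Y X (fun w => by_parts (X w) (Y w) (I w)).
Proof.
move=> mX mY cXY [mI XYI].
have mJ : process (fun w => by_parts (X w) (Y w) (I w)).
  move=> t t0; apply: measurable_funB; last exact: mI.
  by apply: measurable_funB; apply: measurable_funM; auto.
split=> // t t0 s fs e e0; have [st _] := fs.
have e20 : 0 < e / 2 by rewrite divr_gt0.
have mS l c : measurable [set w | c <= `|stieltjes_sum t (s l) (X w) (Y w) - I w t|].
  apply: measurable_ge; apply: measurableT_comp => //.
  by apply: measurable_funB; [exact: measurable_stieltjes_sum|exact: mI].
have mC l c : measurable [set w | c <= `|covariation_sum t (s l) (X w) (Y w) - 0|].
  under eq_set do rewrite subr0.
  apply: measurable_ge; apply: measurableT_comp => //.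
  exact: measurable_covariation_sum.
have mSJ l : measurable [set w |
    e <= `|stieltjes_sum t (s l) (Y w) (X w) - by_parts (X w) (Y w) (I w) t|].
  apply: measurable_ge; apply: measurableT_comp => //.
  by apply: measurable_funB; [exact: measurable_stieltjes_sum|exact: mJ].
apply/prob_cvg0P => // r r0; have r20 : 0 < r / 2 by rewrite divr_gt0.
have /prob_cvg0P - /(_ (fun l => mS l _) _ r20) hS := XYI _ t0 _ fs _ e20.
have /prob_cvg0P - /(_ (fun l => mC l _) _ r20) hC := cXY _ _ t0 fs _ e20.
apply: filterS2 hS hC => l PS PC; rewrite (splitr r) EFinD.
apply: le_trans (leeD PS PC).
apply: le_trans (measureU2 _ _ _) => //.
apply: le_measure; rewrite ?inE//; first exact: measurableU.
move=> w /= eSJ.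
have [|Se] := leP (e / 2) `|stieltjes_sum t (s l) (X w) (Y w) - I w t|; [by left|right].
rewrite /= leNgt; apply/negP => Ce; move: eSJ; apply/negP; rewrite -ltNge.
have := stieltjes_sum_by_parts (X w) (Y w) (st l).
move: Se Ce; rewrite !ltr_norml => /andP[? ?] /andP[? ?] ?.
by apply/andP; split; lra.
Qed.

End integration_by_parts.

(** * Vanishing quadratic variation of fractional Brownian motion for H > 1/2 *)

Section fractional_brownian_motion.
Context {R : realType} {d : measure_display} {T : measurableType d}.
Variables (P : probability T R) (H : R) (B : T -> skorohod R).
Hypotheses (hH : 2^-1 < H) (fB : fractional_brownian_motion P H B).

Lemma fbm_process : process B.
Proof.
case: fB => _ _ gB _ _ t t0.
have [] := gB 1%N (fun=> t) (fun=> 1) (fun=> t0).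
by under eq_fun do rewrite big_ord1 mul1r.
Qed.

Notation integrableR f := (P.-integrable [set: T] (EFin \o f)).

(** The covariance formula on the diagonal gives finite second moments, and the product is dominated
    by the sum of the squares. *)
Lemma fbm_integrable_mul s t : 0 <= s -> 0 <= t ->
  integrableR (fun w => B w s * B w t).
Proof.
move=> s0 t0; have mB := fbm_process; case: fB => _ _ _ _ cov.
have sq u : 0 <= u -> integrableR (fun w => B w u ^+ 2).
  move=> u0; apply/integrableP; split.
    by apply/measurable_EFinP; apply: measurable_funX; exact: mB.
  have := cov u u u0 u0; rewrite unlock => covu.
  under eq_integral => w _.
    rewrite (_ : `|(EFin \o _) w|%E = (B w u * B w u)%:E); last first.
      by rewrite /= ger0_norm ?sqr_ge0// expr2.
  over.
  by rewrite covu ltey.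
apply: (integrable_le (g := fun w => B w s ^+ 2 + B w t ^+ 2)).
- by apply: measurable_funM; exact: mB.
- exact: (integrableD measurableT (sq s s0) (sq t t0)).
move=> w; rewrite ler_norml; have := sqr_ge0 (B w s + B w t).
by have := sqr_ge0 (B w s - B w t); rewrite !expr2 => *; apply/andP; split; lra.
Qed.

(** Expand the square: the powers of [s] and [t] cancel, and the diagonal terms vanish because
    [2 * H] is nonzero. *)
Lemma fbm_increment s t : 0 <= s -> 0 <= t ->
  integrableR (fun w => (B w t - B w s) ^+ 2) /\
  \int[P]_(w in [set: T]) ((B w t - B w s) ^+ 2) = `|t - s| `^ (2 * H).
Proof.
move=> s0 t0; case: (fB) => _ _ _ _ cov.
have covR u v : 0 <= u -> 0 <= v -> \int[P]_(w in [set: T]) (B w u * B w v) =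
    2^-1 * (u `^ (2 * H) + v `^ (2 * H) - `|v - u| `^ (2 * H)).
  move=> u0 v0; have := cov u v u0 v0; rewrite unlock => covuv.
  by rewrite /Rintegral covuv.
have itt := fbm_integrable_mul t0 t0; have iss := fbm_integrable_mul s0 s0.
have ist := fbm_integrable_mul s0 t0.
have ist2 := integrableZl measurableT 2 ist.
have i1 : integrableR (fun w => B w t * B w t - 2 * (B w s * B w t)).
  exact: (integrableB measurableT itt ist2).
have sqE : (fun w => (B w t - B w s) ^+ 2) =
    (fun w => B w t * B w t - 2 * (B w s * B w t) + B w s * B w s).
  by apply/funext => w; ring.
rewrite sqE; split; first exact: (integrableD measurableT i1 iss).
rewrite RintegralD// RintegralB// RintegralZl// !covR// !subrr normr0.
rewrite [0 `^ _]powR0; first by field.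
by rewrite mulf_neq0// gt_eqF// (lt_trans _ hH).
Qed.

(** One factor of each increment of time is kept and sums to [t]; the remaining power [2 * H - 1] is
    positive, hence monotone and bounded through the mesh. *)
Lemma fbm_qv_bound t s : itv_partition 0 t s ->
  integrableR (fun w => qv_sum t s (B w)) /\
  \int[P]_(w in [set: T]) qv_sum t s (B w) <= mesh t s `^ (2 * H - 1) * t.
Proof.
move=> st; pose p i := nth t (0 :: s) i.
have p0 i : 0 <= p i by case/andP: (itv_partition_nth_itv i st).
pose q i w := (B w (p i.+1) - B w (p i)) ^+ 2.
have intq i : integrableR (q i) by have [] := fbm_increment (p0 i) (p0 i.+1).
split; first by apply: (integrable_sumR (f := q)).
rewrite (Rintegral_sum (f := q))//.
have -> : mesh t s `^ (2 * H - 1) * t =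
    \sum_(i < size s) mesh t s `^ (2 * H - 1) * (p i.+1 - p i).
  by rewrite -mulr_sumr (sum_increments id st) subr0.
apply: ler_sum => i _; have [_ ->] := fbm_increment (p0 i) (p0 i.+1).
have dp : 0 <= p i.+1 - p i by rewrite subr_ge0; exact: itv_partition_nth_leS.
have H1 : 0 < 2 * H - 1 by move: hH; lra.
rewrite ger0_norm// (_ : 2 * H = 2 * H - 1 + 1); last by ring.
rewrite powRD; last by rewrite gt_eqF// addr_gt0.
rewrite powRr1// ler_wpM2r//.
have pm : p i.+1 - p i <= mesh t s.
  exact: (@le_bigmax _ _ _ 0 (fun i : 'I_(size s) => p i.+1 - p i) i).
have m0 := le_trans dp pm.
by rewrite addrK; apply: ge0_ler_powR => //; exact: ltW.
Qed.

Lemma fbm_qv_cvg0 t s : fine_partitions t s ->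
  cvg_in_probability P (fun l w => qv_sum t (s l) (B w)) (cst 0).
Proof.
move=> [st mesh0] e e0.
have t0 : 0 <= t by exact: itv_partition_le (st 0).
have H1 : 0 < 2 * H - 1 by move: hH; lra.
apply/prob_cvg0P => [l|r r0].
  under eq_set do rewrite subr0.
  apply: measurable_ge; apply: measurableT_comp => //.
  by apply: measurable_qv_sum => //; exact: fbm_process.
(* Once the power of the mesh is at most [y], Markov's inequality gives at most [r]; [t + 1] avoids
   a division by zero at [t = 0]. The mesh threshold below inverts the power. *)
pose y := r * e / (t + 1); have t10 : 0 < t + 1 by rewrite ltr_wpDl.
have y0 : 0 < y by rewrite divr_gt0// mulr_gt0.
have dl0 : 0 < y `^ (2 * H - 1)^-1 by rewrite powR_gt0.
have /cvgrPdist_lt/(_ _ dl0) := mesh0.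
apply: filterS => l; rewrite sub0r normrN => meshl.
have [intq Eq] := fbm_qv_bound (st l).
have -> : [set w | e <= `|qv_sum t (s l) (B w) - cst 0 w|] =
          [set w | e <= qv_sum t (s l) (B w)].
  by apply: eq_set => w; rewrite subr0 ger0_norm// qv_sum_ge0.
apply: le_trans (markov_Rintegral _ intq e0) _; first by move=> w; exact: qv_sum_ge0.
rewrite lee_fin ler_pdivrMr// (le_trans Eq)//.
have m0 : 0 <= mesh t (s l) by exact: bigmax_ge_id.
have my : mesh t (s l) `^ (2 * H - 1) <= y.
  have -> : y = (y `^ (2 * H - 1)^-1) `^ (2 * H - 1).
    by rewrite -powRrM mulVf ?gt_eqF// powRr1// ltW.
  apply: ge0_ler_powR; rewrite ?nnegrE ?powR_ge0// ?(ltW H1)// ltW//.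
  by rewrite (le_lt_trans _ meshl)// ler_norm.
apply: (@le_trans _ _ (y * (t + 1))).
  by rewrite ler_pM ?powR_ge0// lerDl.
by rewrite /y divfK// gt_eqF.
Qed.

End fractional_brownian_motion.

Theorem theorem4p1 (R : realType)
    (d : nat -> measure_display) (T : forall n, measurableType (d n))
    (P : forall n, probability (T n) R) (F : forall n, R -> set (set (T n)))
    (hF : forall n, filtration (F n))
    (Psi Z : forall n, T n -> skorohod R)
    (Psi_good : good P F Psi)
    (Z_adapted : forall n, adapted (F n) (Z n))
    (Z_zqv : forall n, {ae P n, forall w, zero_quadratic_variation (Z n w)})
    (Z_0 : forall n, P n [set w | Z n w 0 = 0] = 1%E)
    (IPsiZ IZZ : forall n, T n -> skorohod R)
    (hIPsiZ : forall n, stoch_integral (P n) (Psi n) (Z n) (IPsiZ n))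
    (hIZZ : forall n, stoch_integral (P n) (Z n) (Z n) (IZZ n))
    (d' : measure_display) (T' : measurableType d')
    (P' : probability T' R) (F' : R -> set (set T')) (hF' : filtration F')
    (psi BH : T' -> skorohod R) (H : R)
    (psi_semimartingale : semimartingale P' F' psi)
    (psi_continuous : continuous_paths P' psi)
    (hH : 2^-1 < H)
    (hBH : fractional_brownian_motion P' H BH)
    (hcvg : cvg_in_law P (fun n => joint2 (Psi n) (Z n)) P' (joint2 psi BH)) :
  exists2 I : T' -> skorohod R, stoch_integral P' psi BH I &
    cvg_in_law P (fun n => joint3 (Psi n) (Z n) (IPsiZ n)) P' (joint3 psi BH I).
Proof.
have [Psi_semimartingale Psi_cvg] := Psi_good.
have processZ n : process (Z n) by exact: adapted_measurable (hF n) _ (Z_adapted n).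
have processPsi n : process (Psi n).
  by have [adPsi _] := Psi_semimartingale n; exact: adapted_measurable (hF n) _ adPsi.
have process_psi : process psi.
  by have [adpsi _] := psi_semimartingale; exact: adapted_measurable hF' _ adpsi.
have process_BH := fbm_process hBH.
pose J n w := by_parts (Psi n w) (Z n w) (IPsiZ n w).
have intJ n : stoch_integral (P n) (Z n) (Psi n) (J n).
  apply: stoch_integral_by_parts => // t s t0 fs; have [st _] := fs.
  apply: covariation_cvg0 => //.
    exact: (semimartingale_qv_tight (hF n)).
  apply: ae_cvg_in_probability => [l|].
    by apply: measurable_qv_sum => //; exact: processZ.
  by apply: filterS (Z_zqv n) => w /(_ _ t0 _ fs).
have [j intj cvgj] :=
  Psi_cvg Z J Z_adapted intJ _ _ P' psi BH process_psi process_BH hcvg.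
exists (fun w => by_parts (psi w) (BH w) (j w)).
  (* [by_parts] is symmetric in its first two arguments; the swap lets the lemma start from [intj],
     the integral of [BH] against [psi]. *)
  have -> : (fun w => by_parts (psi w) (BH w) (j w)) =
            (fun w => by_parts (BH w) (psi w) (j w)).
    apply/funext => w; apply: skorohod_eq => t /=.
    by rewrite (mulrC (psi w t)) (mulrC (psi w 0)).
  apply: stoch_integral_by_parts => // t s t0 fs; have [st _] := fs.
  (* The covariation is symmetric too, which gives [psi] the tight role and [BH] the vanishing
     one. *)
  have covC : (fun l w => covariation_sum t (s l) (BH w) (psi w)) =
              (fun l w => covariation_sum t (s l) (psi w) (BH w)).
    by apply/funext => l; apply/funext => w; apply: eq_bigr => i _; rewrite mulrC.
  rewrite covC; apply: covariation_cvg0 => //.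
    exact: (semimartingale_qv_tight hF').
  exact: (fbm_qv_cvg0 hH hBH).
(* Continuous mapping: goodness is tested on [G \o by_parts_map], and [by_partsK] cancels the two
   integrations by parts before the limit. *)
move=> G contG [M GM].
have contGb : continuous (G \o by_parts_map).
  by move=> x; apply: continuous_comp; [exact: by_parts_map_continuous|exact: contG].
have GbM : exists M : R, forall x, `|(G \o by_parts_map) x| <= M.
  by exists M => x; exact: GM.
have := cvgj _ contGb GbM.
have -> : (fun w => (G \o by_parts_map) (joint3 psi BH j w)) =
  (fun w => G (joint3 psi BH (fun w => by_parts (psi w) (BH w) (j w)) w)).
  by apply/funext => w; rewrite /= by_parts_map_pair.
suff -> : (fun n => 'E_(P n)[fun w => (G \o by_parts_map) (joint3 (Psi n) (Z n) (J n) w)])%E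
  = (fun n => 'E_(P n)[fun w => G (joint3 (Psi n) (Z n) (IPsiZ n) w)])%E by [].
apply/funext => n; congr expectation.
by apply/funext => w; rewrite /= by_parts_map_pair by_partsK.
Qed.
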